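(* Let $m$, $n$, and $t$ be positive integers, and let $G=\mathbb{Z}_n$ be the cyclic group of order $n$. 1. If $n=2$, then the set $\{1\}$ is a tight $1$-independent set in $G$. 2. If $n=2m+1$, then the set $\{1,2,\dots,m\}$ is a tight $2$-independent set in $G$. 3. If $n=4m$, then the set $\{1,3,\dots,2m-1\}$ is a tight $3$-independent set in $G$. 4. If $n=t+1$, then the set $\{1\}$ is a tight $t$-independent set in $G$. 5. Let $n=\lfloor t^2/2\rfloor+t+1$. If $t$ is even, then the set $\{t/2,\,t/2+1\}$ is a tight $t$-independent set in $G$; if $t$ is odd, then the set $\{1,t\}$ is a tight $t$-independent set in $G$. 6. If $n=38$, then the set $\{1,7,11\}$ is a tight $5$-independent set in $G$.
   Context: The numbers $a(m,s)$, for non-negative integers $m,s$, are defined recursively by $a(m,0)=a(0,s)=1$ and, for $m,s\ge 1$, $a(m,s)=a(m-1,s)+a(m,s-1)+a(m-1,s-1)$. For positive integers $m,t$ put $q(m,t)=a(m,t/2)$ if $t$ is even, and $q(m,t)=a(m,(t-1)/2)+a(m-1,(t-1)/2)$ if $t$ is odd. Let $G$ be a finite abelian group written additively and $A=\{a_1,\dots,a_m\}$ a subset of $G$ of size $m$. $A$ is a $t$-independent set in $G$ if, whenever $\lambda_1a_1+\cdots+\lambda_m a_m=0$ for some integers $\lambda_1,\dots,\lambda_m$ with $|\lambda_1|+\cdots+|\lambda_m|\le t$, we have $\lambda_1=\cdots=\lambda_m=0$. A $t$-independent set $A$ of size $m$ in $G$ is called a tight $t$-independent set in $G$ if $|G|=q(m,t)$.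 (Here the size of $A$ is its number of distinct elements; for $t=1$ the set $\{1,t\}$ is just $\{1\}$.) Integers are regarded as elements of $\mathbb{Z}_n$ via reduction modulo $n$. *)

(* Defs.v *)
From HB Require Import structures.
From mathcomp Require Import all_boot all_order all_algebra.
Set Implicit Arguments.
Unset Strict Implicit.
Unset Printing Implicit Defensive.

Import GRing.Theory.
Local Open Scope ring_scope.

Fixpoint delannoy (m : nat) : nat -> nat :=
  fix row (s : nat) : nat :=
    match m, s with
    | 0, _ | _, 0 => 1%N
    | m'.+1, s'.+1 => (delannoy m' s + row s' + delannoy m' s')%N
    end.

(* For odd t, t./2 is (t - 1) / 2. Only m, t >= 1 are meaningful. *)
Definition q (m t : nat) : nat :=
  if odd t then (delannoy m t./2 + delannoy m.-1 t./2)%N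
  else delannoy m t./2.

(* The integer coefficients are indexed by the elements of A rather than by an
   enumeration of A; the values of lambda outside A play no role. *)
Definition t_independent (G : finZmodType) (t : nat) (A : {set G}) : Prop :=
  forall lambda : G -> int,
    (\sum_(a in A) `|lambda a| <= t)%N ->
    \sum_(a in A) a *~ lambda a = 0 ->
    forall a, a \in A -> lambda a = 0.

Definition tight_t_independent (G : finZmodType) (t : nat) (A : {set G}) : Prop :=
  t_independent t A /\ #|G| = q #|A| t.

(* 'Z_n is the cyclic group of order n only for n >= 2. *)
Definition residues (n : nat) (s : seq nat) : {set 'Z_n} :=
  [set:: [seq k%:R | k <- s]].

(* Main.v *)
(* An integer combination of the generators, of weight at most t and divisible
   by n, is a small multiple of n by size.  When n is even and all generators
   are odd, its weight is even, which improves the bound t = 3, 5 or, in part 5,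
   t = 2s+1, by one.  The multiple of n is then 0, and a vanishing integer
   combination of so small a weight has zero coefficients: two distinct positive
   integers do not cancel, and x s + y (s+1) = 0 makes (x, y) a multiple of
   (s+1, -s), of weight 2s+1. *)
Require Import Defs.
From mathcomp Require Import all_boot all_order all_algebra.
From mathcomp Require Import zify.

Import GRing.Theory Num.Theory.
Local Open Scope ring_scope.

(** * From combinations in ['Z_n] to integer combinations divisible by [n] *)

Lemma natr_Zp_eq0 (n k : nat) : (1 < n)%N -> ((k%:R : 'Z_n) == 0) = (n %| k)%N.
Proof. by move=> n1; rewrite -val_eqE /= val_Zp_nat. Qed.

Lemma intr_Zp_eq0 (n : nat) (z : int) :
  (1 < n)%N -> ((z%:~R : 'Z_n) == 0) = (n %| z)%Z.
Proof.
move=> n1; rewrite dvdzE; case: z => k; first by rewrite -natr_Zp_eq0.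
by rewrite NegzE mulrNz oppr_eq0 -natr_Zp_eq0.
Qed.

(** Distinct integers below [n] have distinct residues, so sums over the set become sums over the
    list [s], and [c k] is [lam] read at the residue of [k]. *)
Lemma tight_residues (n t : nat) (s : seq nat) :
  (1 < n)%N -> uniq s -> {in s, forall k, (k < n)%N} -> n = q (size s) t ->
  (forall c : nat -> int, (\sum_(k <- s) `|c k| <= t)%N ->
     (n %| \sum_(k <- s) c k * k%:Z)%Z -> {in s, forall k, c k = 0}) ->
  tight_t_independent t (residues n s).
Proof.
move=> n1 us sn nq indep.
have u_res : uniq [seq k%:R : 'Z_n | k <- s].
  rewrite map_inj_in_uniq // => i j /sn i_lt /sn j_lt /(congr1 val).
  by rewrite /= !val_Zp_nat // !modn_small.
have big_res (R : nmodType) (F : 'Z_n -> R) :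
    \sum_(a in residues n s) F a = \sum_(k <- s) F k%:R.
  rewrite -(big_map (fun k : nat => k%:R : 'Z_n) xpredT F) /=.
  rewrite big_uniq //; apply: eq_bigl => a; by rewrite inE.
split.
  move=> lam.
  rewrite (big_res nat (fun a => `|lam a|%N)) (big_res _ (fun a => a *~ lam a)).
  move=> le_t eq0 a; rewrite inE => /mapP[k ks ->].
  apply: (indep (fun k => lam k%:R)) => //.
  rewrite -intr_Zp_eq0 // rmorph_sum -[X in _ == X]eq0 /=.
  by apply/eqP/eq_bigr => i _; rewrite mulrC mulrzA.
have -> : #|residues n s| = size s.
  rewrite -[RHS](size_map (fun k : nat => k%:R : 'Z_n)) -(card_uniqP u_res).
  by apply: eq_card => a; rewrite inE.
by rewrite card_ord Zp_cast.
Qed.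

(** * Closed forms of [q] for small arguments *)

Lemma delannoym0 m : delannoy m 0 = 1%N. Proof. by case: m. Qed.

Lemma delannoy0s s : delannoy 0 s = 1%N. Proof. by case: s. Qed.

Lemma delannoySS m s :
  delannoy m.+1 s.+1 = (delannoy m s.+1 + delannoy m.+1 s + delannoy m s)%N.
Proof. by []. Qed.

Lemma delannoy1 s : delannoy 1 s = (s.*2.+1)%N.
Proof. by elim: s => // s IH; rewrite delannoySS IH !delannoy0s; lia. Qed.

Lemma delannoy2 s : delannoy 2 s = (2 * s ^ 2 + 2 * s + 1)%N.
Proof. by elim: s => // s IH; rewrite delannoySS IH !delannoy1; nia. Qed.

Lemma delannoym1 m : delannoy m 1 = (m.*2.+1)%N.
Proof. by elim: m => // m IH; rewrite delannoySS IH !delannoym0; lia. Qed.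

Lemma q1 t : q 1 t = t.+1.
Proof. by rewrite /q delannoy1 delannoy0s; case: ifP => ?; lia. Qed.

Lemma q2 t : q 2 t = (t ^ 2 %/ 2 + t + 1)%N.
Proof.
rewrite /q delannoy2 delannoy1; have := odd_double_half t.
by case: odd => /=; move: t./2 => s <-; nia.
Qed.

(** * Size, weight and parity of integer combinations *)

Lemma normz_comb_le (s : seq nat) (c : nat -> int) (B : nat) :
  {in s, forall k, (k <= B)%N} ->
  (`|(\sum_(k <- s) c k * k%:Z)%R| <= (\sum_(k <- s) `|c k|) * B)%N.
Proof.
elim: s => [|k s IH] sB; first by rewrite !big_nil.
have /IH : {in s, forall j, (j <= B)%N}.
  by move=> j js; rewrite sB // inE js orbT.
have : (`|(c k * k%:Z)%R| <= `|c k| * B)%N.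
  by rewrite abszM leq_mul2l (sB k) ?mem_head ?orbT.
by rewrite !big_cons mulnDl; move: (\sum_(j <- s) _)%N (\sum_(j <- s) _)%R; lia.
Qed.

Lemma comb_weight0 (s : seq nat) (c : nat -> int) :
  (\sum_(k <- s) `|c k| = 0)%N -> \sum_(k <- s) c k * k%:Z = 0.
Proof.
move=> w0; apply/eqP; rewrite -absz_eq0 -leqn0.
(* Any bound on the elements of [s] would do here, since it is multiplied by weight 0. *)
apply: leq_trans (@normz_comb_le s c (\max_(k <- s) k) _) _; last by rewrite w0.
by move=> k ks; apply: leq_bigmax_seq.
Qed.

(** At most one coefficient is nonzero, and it is 1 or -1. *)
Lemma comb_weight1 (s : seq nat) (c : nat -> int) :
  (\sum_(k <- s) `|c k| <= 1)%N ->
  `|(\sum_(k <- s) c k * k%:Z)%R|%N \in 0%N :: s.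
Proof.
elim: s => [|k s IH]; first by rewrite !big_nil.
rewrite !big_cons => w1.
have [ck|ck] := eqVneq (c k) 0.
  rewrite ck mul0r add0r; move: w1; rewrite ck add0n => /IH.
  by rewrite !inE => /orP[] ->; rewrite ?orbT.
have w0 : (\sum_(k <- s) `|c k| = 0)%N by lia.
rewrite comb_weight0 // addr0 abszM (_ : `|c k|%N = 1%N); last by lia.
by rewrite mul1n !inE eqxx orbT.
Qed.

(** If [c k] is nonzero, the other terms sum to [- c k * k] with weight at most 1. For [c k] = ±1
    this makes [k] another element of [s]; for [c k] = ±2 the other terms vanish. *)
Lemma comb_weight2_eq0 (s : seq nat) (c : nat -> int) :
  uniq s -> 0%N \notin s -> (\sum_(k <- s) `|c k| <= 2)%N ->
  \sum_(k <- s) c k * k%:Z = 0 -> {in s, forall k, c k = 0}.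
Proof.
move=> us s0 w2 eq0 k ks; apply/eqP/contraT => ck.
have k0 : k != 0%N by apply: contraNneq s0 => <-.
move: w2 eq0; rewrite !(big_rem k ks) /= => w2 /eqP.
rewrite addr_eq0 => /eqP eqS.
move: w2; set w := (\sum_(_ <- _) _)%N => w2.
have /comb_weight1 : (w <= 1)%N by lia.
rewrite -abszN -eqS abszM inE muln_eq0 !absz_eq0 (negPf ck) eqz_nat (negPf k0) /=.
have [c1|c2] : (`|c k| = 1)%N \/ (`|c k| = 2)%N by lia.
  by rewrite c1 mul1n mem_rem_uniqF.
have /comb_weight0 S0 : w = 0%N by lia.
by move/eqP: eqS; rewrite S0 oppr0 mulf_eq0 (negPf ck) eqz_nat (negPf k0).
Qed.

Lemma weight_parity (s : seq nat) (c : nat -> int) :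
  {in s, forall k, odd k} ->
  odd `|(\sum_(k <- s) c k * k%:Z)%R|%N = odd (\sum_(k <- s) `|c k|)%N.
Proof.
elim: s => [|k s IH] odds; first by rewrite !big_nil.
rewrite !big_cons oddD -IH => [|j js]; last by rewrite odds // inE js orbT.
have -> (x y : int) : odd `|(x + y)%R|%N = odd `|x|%N (+) odd `|y|%N by lia.
by rewrite abszM oddM absz_nat (odds k) ?mem_head ?andbT.
Qed.

Lemma dvdz_small (n : nat) (z : int) : (n %| z)%Z -> (`|z| < n)%N -> z = 0.
Proof.
rewrite dvdzE /= => nz zn; apply/eqP; rewrite -absz_eq0.
by apply: contraTT zn; rewrite -lt0n -leqNgt => z0; apply: dvdn_leq.
Qed.

(** * The individual families of sets *)

Lemma tight_iota (m : nat) :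
  (0 < m)%N -> tight_t_independent 2 (residues (2 * m + 1) (iota 1 m)).
Proof.
move=> m0; apply: tight_residues => [||k||c w2 ndiv].
- lia.
- exact: iota_uniq.
- rewrite mem_iota; lia.
- by rewrite size_iota /q /= delannoym1; lia.
apply: comb_weight2_eq0 => //; first exact: iota_uniq.
  by rewrite mem_iota.
apply: (dvdz_small _ _ ndiv).
apply: leq_ltn_trans (@normz_comb_le _ _ m _) _; last by nia.
by move=> k; rewrite mem_iota; lia.
Qed.

Lemma tight_odds (m : nat) :
  (0 < m)%N ->
  tight_t_independent 3 (residues (4 * m) [seq (2 * i + 1)%N | i <- iota 0 m]).
Proof.
set s := map _ _ => m0.
have us : uniq s by rewrite map_inj_uniq ?iota_uniq // => i j; lia.
have odds : {in s, forall k, odd k} by move=> k /mapP[i _ ->]; lia.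
have s_le : {in s, forall k, (k <= 2 * m - 1)%N}.
  by move=> k /mapP[i]; rewrite mem_iota => + ->; lia.
apply: tight_residues => // [|k /s_le||c w3 ndiv]; [lia|lia|..].
  by rewrite size_map size_iota /q /= !delannoym1; lia.
(* Divisibility by [4 * m] makes the combination even, so weight 3 is excluded. *)
have w2 : (\sum_(k <- s) `|c k| <= 2)%N.
  have := weight_parity s c odds; move: ndiv; rewrite dvdzE /=; lia.
apply: comb_weight2_eq0 => //; first by apply/negP => /odds.
apply: (dvdz_small _ _ ndiv).
by apply: leq_ltn_trans (normz_comb_le _ _ _ s_le) _; nia.
Qed.

Lemma tight_one (t : nat) :
  (0 < t)%N -> tight_t_independent t (residues (t + 1) [:: 1%N]).
Proof.
move=> t0; apply: tight_residues => //=; rewrite ?q1; try lia.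
  by move=> k; rewrite inE; lia.
move=> c; rewrite !big_seq1 mulr1 => w ndiv k; rewrite inE => /eqP ->.
by apply: (dvdz_small _ _ ndiv); lia.
Qed.

Lemma tight_pair_even (t : nat) : (0 < t)%N -> ~~ odd t ->
  tight_t_independent t (residues (t ^ 2 %/ 2 + t + 1)
    [:: (t %/ 2)%N; (t %/ 2 + 1)%N]).
Proof.
move=> t0 et; set s := (t %/ 2)%N; have ts : t = (2 * s)%N by lia.
have -> : (t ^ 2 %/ 2 + t + 1 = 2 * s ^ 2 + 2 * s + 1)%N by nia.
rewrite ts; apply: tight_residues => //=.
- nia.
- by rewrite inE; lia.
- by move=> k; rewrite !inE => /orP[] /eqP ->; nia.
- by rewrite q2; nia.
move=> c; rewrite !big_cons !big_nil addn0 addr0 => w ndiv.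
suff [cs0 cs1] : c s = 0 /\ c (s + 1)%N = 0.
  by move=> k; rewrite !inE => /orP[] /eqP ->.
move: (c s) (c (s + 1)%N) w ndiv => x y w /dvdz_small eq0.
(* The size is at most 2s(s+1), one less than the order of the group. *)
have {eq0} : x * s + y * (s + 1)%N = 0 by apply: eq0; nia.
have [->|y_neq0] := eqVneq y 0.
  by rewrite mul0r addr0 => /eqP; rewrite mulf_eq0 => /orP[] /eqP; lia.
move=> eq0.
have eqxy : (`|x| * s = `|y| * s.+1)%N.
  by rewrite -[s in LHS]absz_nat -[s.+1]absz_nat -!abszM; lia.
have x_dvd : (s.+1 %| `|x|)%N.
  by rewrite -(@Gauss_dvdl s.+1 _ s) ?coprimeSn // eqxy dvdn_mull.
have y_dvd : (s %| `|y|)%N.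
  by rewrite -(@Gauss_dvdl s _ s.+1) ?coprimenS // -eqxy dvdn_mull.
have y_gt0 : (0 < `|y|)%N by lia.
have x_gt0 : (0 < `|x|)%N by nia.
by have := dvdn_leq x_gt0 x_dvd; have := dvdn_leq y_gt0 y_dvd; lia.
Qed.

Lemma tight_pair_odd (t : nat) : odd t ->
  tight_t_independent t (residues (t ^ 2 %/ 2 + t + 1) [:: 1%N; t]).
Proof.
have [->|t1] := eqVneq t 1%N.
  (* For [t] = 1 the list has a repetition and [tight_residues] does not apply. *)
  have -> : residues (1 ^ 2 %/ 2 + 1 + 1) [:: 1; 1]%N = residues (1 + 1) [:: 1%N].
    by apply/setP => a; rewrite !inE orbb.
  by move=> _; apply: tight_one.
move=> ot; have [s ts] : exists s, t = (2 * s + 1)%N by exists t./2; lia.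
have nE : (t ^ 2 %/ 2 + t + 1 = 2 * (s + 1) ^ 2)%N by nia.
apply: tight_residues => //=.
- nia.
- by rewrite inE; lia.
- by move=> k; rewrite !inE => /orP[] /eqP ->; nia.
- by rewrite q2.
move=> c; rewrite nE !big_cons !big_nil addn0 addr0 => w ndiv.
suff [c1 ct] : c 1%N = 0 /\ c t = 0.
  by move=> k; rewrite !inE => /orP[] /eqP ->.
move: (c 1%N) (c t) w ndiv => x y w /dvdzP[k]; rewrite mulr1 ts => eqk.
(* The size is at most (2s+1)^2, less than twice the order 2(s+1)^2. *)
have k1 : -1 <= k <= 1 by nia.
have [k0|[k0|k0]] : k = 0 \/ k = 1 \/ k = -1 by lia.
(* Here x = -ty has weight (t+1)|y| together with y, so y must be 0. *)
- have y1 : -1 <= y <= 1 by nia.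
  have : y = 0 \/ y = 1 \/ y = -1 by lia.
  by case=> [|[]] y0; rewrite y0 k0 in eqk; lia.
(* The weight is even, and then y = (2(s+1)^2 - x) / (2s+1) would lie strictly
   between s+1 and s+2. *)
- have w2 : (`|x| + `|y| <= 2 * s)%N by nia.
  have : s.+1%:Z < y by nia.
  have : y < s.+2%:Z by nia.
  lia.
(* The same argument applied to (-x, -y). *)
have w2 : (`|x| + `|y| <= 2 * s)%N by nia.
have : s.+1%:Z < - y by nia.
have : - y < s.+2%:Z by nia.
lia.
Qed.

Lemma tight_38 : tight_t_independent 5 (residues 38 [:: 1; 7; 11]%N).
Proof.
(* The order is computed: q(3,5) = 25 + 13 = 38. *)
apply: tight_residues => //= [k|c].
  by rewrite !inE => /or3P[] /eqP ->.
rewrite !big_cons !big_nil addn0 addr0 => w ndiv.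
suff [c1 [c7 c11]] : c 1%N = 0 /\ c 7%N = 0 /\ c 11%N = 0.
  by move=> k; rewrite !inE => /or3P[] /eqP ->.
move: (c 1%N) (c 7%N) (c 11%N) w ndiv => x y z w /dvdzP[k] eqk.
(* The size is at most 5 * 11 = 55 < 2 * 38. *)
have k1 : -1 <= k <= 1 by lia.
(* A finite check. For k = ±1 the weight is even, hence at most 4, and the largest values of weight
   4 are 44, 40, 36, which skip 38. *)
lia.
Qed.

Local Close Scope ring_scope.

Theorem proposition13 (m n t : nat) (hm : 0 < m) (hn : 0 < n) (ht : 0 < t) :
  (n = 2 -> tight_t_independent 1 (residues n [:: 1])) /\
  (n = 2 * m + 1 -> tight_t_independent 2 (residues n (iota 1 m))) /\
  (n = 4 * m ->
     tight_t_independent 3 (residues n [seq 2 * i + 1 | i <- iota 0 m])) /\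
  (n = t + 1 -> tight_t_independent t (residues n [:: 1])) /\
  (n = t ^ 2 %/ 2 + t + 1 ->
     (~~ odd t -> tight_t_independent t (residues n [:: t %/ 2; t %/ 2 + 1])) /\
     (odd t -> tight_t_independent t (residues n [:: 1; t]))) /\
  (n = 38 -> tight_t_independent 5 (residues n [:: 1; 7; 11])).
Proof.
(* The first claim is the fourth at [t] = 1. *)
split; first by move=> ->; apply: (tight_one 1).
split; first by move=> ->; apply: tight_iota.
split; first by move=> ->; apply: tight_odds.
split; first by move=> ->; apply: tight_one.
split; last by move=> ->; apply: tight_38.
move=> ->; split=> t_parity; last exact: tight_pair_odd.
exact: tight_pair_even.
Qed.
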